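(* Let $k\ge 2$ be an even integer, $\ell\ge 1$ an integer and $0<\epsilon<1$. The sample complexity of $(k,\epsilon)$-distribution learning using $\mathcal{W}_\ell$ for public-coin protocols is $\Omega\!\left(\frac{k^2}{2^\ell\epsilon^2}\right)$, i.e., at least $c\,\frac{k^2}{2^\ell\epsilon^2}$ for a universal constant $c>0$.
   Context: Notation: $[k]=\{1,\dots,k\}$; $\Delta_k$ is the set of probability distributions on $[k]$; $d_{TV}(\mathbf p,\mathbf q)=\frac12\sum_{x}|\mathbf p(x)-\mathbf q(x)|$. A channel $W$ from $[k]$ to a finite set $\mathcal Y$ is a stochastic matrix with entries $W(y\mid x)$ (probability of output $y$ on input $x$). $\mathcal{W}_\ell$ is the family of all channels from $[k]$ to $\{0,1\}^\ell$. Distributed model: there are $n$ players; $X_1,\dots,X_n$ are i.i.d. from an unknown $\mathbf p\in\Delta_k$ and player $i$ holds $X_i$. Player $i$ selects a channel $W_i\in\mathcal W$ and sends to a referee the output $Y_i$ of $W_i$ on input $X_i$ (the randomness used to realize channel outputs is independent across players and not seen by the referee). In a public-coin protocol, a random variable $U$ independent of $X^n$ is available to all players and to the referee, each $W_i$ is a function of $U$, and the referee's output may depend on $(Y^n,U)$. In a private-coin protocol, $U_1,\dots,U_n$ are mutually independent and independent of $X^n$, $W_i$ is a function of $U_i$ only, and the referee sees only $Y^n$ (it knows the mappings $U_i\mapsto W_i$ but not the realizations). An $(n,\epsilon)$-estimator using $\mathcal W$ consists of such a protocol together with a referee mapping $\hat{\mathbf p}$ into $\Delta_k$ such that for every $\mathbf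 p\in\Delta_k$, $\Pr[d_{TV}(\hat{\mathbf p},\mathbf p)>\epsilon]<1/12$. The sample complexity of $(k,\epsilon)$-distribution learning using $\mathcal W$ for public-coin (resp. private-coin) protocols is the least $n$ for which an $(n,\epsilon)$-estimator using $\mathcal W$ with a public-coin (resp. private-coin) protocol exists.
   Formalization: The range 0<ε<1 is replaced by 0<ε<1/2: for ε ≥ 1−1/k the constant uniform estimate already succeeds with no samples, so the claim fails as stated (for k=2, at every ε in [1/2,1)). *)

(* Defs.v *)
From HB Require Import structures.
From mathcomp Require Import all_boot all_order all_algebra.
From mathcomp Require Import all_classical all_reals all_analysis.

Set Implicit Arguments.
Unset Strict Implicit.
Unset Printing Implicit Defensive.

Import Order.TTheory GRing.Theory Num.Theory.
Import numFieldNormedType.Exports.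

Local Open Scope classical_set_scope.
Local Open Scope ring_scope.

Record dist (R : realType) (A : finType) := Dist {
  pmf :> A -> R;
  pmf_ge0 : forall a, 0 <= pmf a;
  pmf_sum1 : \sum_(a : A) pmf a = 1 }.

Definition dTV (R : realType) (A : finType) (p q : dist R A) : R :=
  2^-1 * \sum_(a : A) `|p a - q a|.

(* [W x y] is the probability W(y | x) of output y on input x. *)
Definition channel (R : realType) (k : nat) (Y : finType) : Type :=
  'I_k -> dist R Y.

Definition all_channels (R : realType) (k l : nat) :
  set (channel R k (l.-tuple bool)) := setT.
Arguments all_channels : clear implicits.

(* [coin_law] is the law of the public randomness U, on an arbitrary
   measurable space; [chan u i] is the channel W_i chosen by player i when
   U = u. *)
Record public_coin_protocol (R : realType) (k : nat) (Y : finType)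
    (F : set (channel R k Y)) (n : nat) := PublicCoinProtocol {
  coin_display : measure_display;
  coin : measurableType coin_display;
  coin_law : probability coin R;
  chan : coin -> 'I_n -> channel R k Y;
  chan_in : forall u i, F (chan u i);
  chan_measurable : forall i x y,
    measurable_fun [set: coin] (fun u => chan u i x y) }.

Record referee (R : realType) (k : nat) (Y : finType)
    (F : set (channel R k Y)) (n : nat)
    (Pi : public_coin_protocol F n) := Referee {
  estimate :> coin Pi -> {ffun 'I_n -> Y} -> dist R 'I_k;
  estimate_measurable : forall y a,
    measurable_fun [set: coin Pi] (fun u => estimate u y a) }.

(* Conditional probability of (X^n, Y^n) = (x, y) given U, where W i is the
   channel of player i: the X_i are i.i.d. with law p, independent of U, and
   the randomness of the channels is independent across players. *)
Definition transcript_pmf (R : realType) (k : nat) (Y : finType) (n : nat)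
    (W : 'I_n -> channel R k Y) (p : dist R 'I_k)
    (x : {ffun 'I_n -> 'I_k}) (y : {ffun 'I_n -> Y}) : R :=
  \prod_(i < n) (p (x i) * W i (x i) (y i)).

(* Pr[d_TV(phat(Y^n, U), p) > eps] under the joint law of (U, X^n, Y^n). *)
Definition error_probability (R : realType) (k : nat) (Y : finType)
    (F : set (channel R k Y)) (n : nat) (Pi : public_coin_protocol F n)
    (phat : referee Pi) (eps : R) (p : dist R 'I_k) : \bar R :=
  \int[coin_law Pi]_u
    (\sum_(x : {ffun 'I_n -> 'I_k})
     \sum_(y : {ffun 'I_n -> Y} | eps < dTV (phat u y) p)
       transcript_pmf (chan u) p x y)%:E.

Definition public_coin_estimator (R : realType) (k : nat) (Y : finType)
    (F : set (channel R k Y)) (n : nat) (eps : R)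
    (Pi : public_coin_protocol F n) (phat : referee Pi) : Prop :=
  forall p : dist R 'I_k, (error_probability phat eps p < (12^-1)%:E)%E.

(* The infimum of a nonempty set of naturals is its least element; the value
   is +oo when no number of players suffices. *)
Definition public_coin_sample_complexity (R : realType) (k : nat)
    (Y : finType) (F : set (channel R k Y)) (eps : R) : \bar R :=
  ereal_inf [set n%:R%:E | n in
    [set n : nat | exists (Pi : public_coin_protocol F n) (phat : referee Pi),
       public_coin_estimator eps phat]].

(* Main.v *)
(** Let [p_z] be the [(1 - g, g)]-mixture of the uniform law and of the uniform
law on one point, chosen by [z b], in each of [m] blocks of [M] points. By
Cauchy-Schwarz and [W x y <= 1], the squared Hellinger distances between the
channel outputs under [p_z] and under [p_z] with one coordinate changed, summed
over all [m * M] such changes, are [O(g^2 2^l / k)], so each is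
[O(g^2 2^l / k^2)] on average. They add up over the [n] players; hence if [n] is
much smaller than [k^2 / (2^l g^2)], re-randomizing a coordinate of a uniform [z]
hardly moves the transcript, and the referee does about as badly as without any sample.

For [eps < 7/32] take [M = 2] and [g = 4 eps]. For larger [eps] binary blocks are
not enough, since a guess that knows nothing may be at distance [1/2] of [p_z]:
with [M = 8] and [g = 7/8] such a guess is at distance [3/4] on average. If
moreover [k < 8], it remains to exclude [n = 0]. *)

Require Import Defs.
From mathcomp Require Import all_boot all_order all_algebra.
From mathcomp Require Import all_classical all_reals all_analysis.
From mathcomp Require Import measurable_realfun.
From mathcomp Require Import ring lra zify.

Set Implicit Arguments.
Unset Strict Implicit.
Unset Printing Implicit Defensive.

Import Order.TTheory GRing.Theory Num.Theory.

Local Open Scope ring_scope.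

(** * Hellinger distance of product laws *)

Lemma prod_one_sub_le (R : realDomainType) (n : nat) (a : 'I_n -> R) :
  (forall i, 0 <= a i <= 1) -> 1 - \prod_i a i <= \sum_i (1 - a i).
Proof.
elim: n a => [a _|n IHn a a01]; first by rewrite !big_ord0 subrr.
rewrite !big_ord_recl.
have /andP[a0 a1] := a01 ord0.
have := IHn (fun i => a (lift ord0 i)) (fun i => a01 _).
set p := \prod_(i < n) _; set s := \sum_(i < n) _ => le_ps.
have p1 : p <= 1 by apply: prodr_ile1 => i _; exact: a01.
by nra.
Qed.

(** Factor [a - b] through the square roots and use [a <= (sqrt a + sqrt b)^2]. The product form
    avoids a division by [a], which may be 0. *)
Lemma sqr_sqrt_sub_le (R : rcfType) (a b : R) : 0 <= a -> 0 <= b ->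
  (Num.sqrt a - Num.sqrt b) ^+ 2 * a <= (a - b) ^+ 2.
Proof.
move=> a0 b0.
have := sqr_sqrtr a0; have := sqr_sqrtr b0.
have := sqrtr_ge0 a; have := sqrtr_ge0 b.
move: (Num.sqrt a) (Num.sqrt b) => s t t0 s0 <- <-.
rewrite (_ : (s ^+ 2 - t ^+ 2) ^+ 2 = (s - t) ^+ 2 * (s + t) ^+ 2); last by ring.
by apply: ler_wpM2l; [exact: sqr_ge0|rewrite ler_sqr ?nnegrE ?addr_ge0 ?lerDl].
Qed.

Lemma sqrtr_prod (R : rcfType) (n : nat) (a : 'I_n -> R) :
  (forall i, 0 <= a i) -> Num.sqrt (\prod_i a i) = \prod_i Num.sqrt (a i).
Proof.
elim: n a => [a _|n IHn a a0]; first by rewrite !big_ord0 sqrtr1.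
by rewrite !big_ord_recl sqrtrM ?a0// IHn.
Qed.

(* The squared Hellinger distance adds up over independent coordinates. It enters
   linearly, at the price of the free parameter [t], so that the bound can be
   averaged over many pairs [P], [Q]. *)
Lemma sum_dist_prod_le (R : rcfType) (Y : finType) (n : nat)
    (P Q : 'I_n -> Y -> R) (t : R) :
  (forall i y, 0 <= P i y) -> (forall i y, 0 <= Q i y) ->
  (forall i, \sum_y P i y = 1) -> (forall i, \sum_y Q i y = 1) -> 0 < t ->
  \sum_(y : {ffun 'I_n -> Y}) `|\prod_i P i (y i) - \prod_i Q i (y i)| <=
    (\sum_i \sum_y (Num.sqrt (P i y) - Num.sqrt (Q i y)) ^+ 2) / (2 * t) + 2 * t.
Proof.
move=> P0 Q0 P1 Q1 t0.
(* [bc i] is the Bhattacharyya coefficient, which multiplies over independent coordinates ([ST]). *)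
pose bc i := \sum_y Num.sqrt (P i y) * Num.sqrt (Q i y).
pose S (y : {ffun 'I_n -> Y}) := Num.sqrt (\prod_i P i (y i)).
pose T (y : {ffun 'I_n -> Y}) := Num.sqrt (\prod_i Q i (y i)).
have prodP0 (y : {ffun 'I_n -> Y}) : 0 <= \prod_i P i (y i) by exact: prodr_ge0.
have prodQ0 (y : {ffun 'I_n -> Y}) : 0 <= \prod_i Q i (y i) by exact: prodr_ge0.
have S2 : \sum_y S y ^+ 2 = 1.
  under eq_bigr => y _ do rewrite sqr_sqrtr//.
  by rewrite -bigA_distr_bigA/= big1.
have T2 : \sum_y T y ^+ 2 = 1.
  under eq_bigr => y _ do rewrite sqr_sqrtr//.
  by rewrite -bigA_distr_bigA/= big1.
have ST : \sum_y S y * T y = \prod_i bc i.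
  rewrite bigA_distr_bigA/=; apply: eq_bigr => y _.
  by rewrite /S /T !sqrtr_prod// -big_split.
have bcE i : \sum_y (Num.sqrt (P i y) - Num.sqrt (Q i y)) ^+ 2 = 2 * (1 - bc i).
  transitivity (\sum_y (P i y + Q i y - 2 * (Num.sqrt (P i y) * Num.sqrt (Q i y)))).
    apply: eq_bigr => y _; rewrite sqrrB !sqr_sqrtr//; ring.
  by rewrite !big_split/= P1 Q1 sumrN -mulr_sumr -/(bc i); ring.
have bc01 i : 0 <= bc i <= 1.
  apply/andP; split; first by apply: sumr_ge0 => y _; rewrite mulr_ge0 ?sqrtr_ge0.
  by rewrite -subr_ge0 -(pmulr_rge0 _ (ltr0n _ 2)) -bcE sumr_ge0// => y _; exact: sqr_ge0.
(* Pointwise [|s^2 - r^2| = |s - r| (s + r)]; Young's inequality with weight [t] splits the product,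
   and [(s + r)^2 <= 2 s^2 + 2 r^2]. *)
have main : \sum_(y : {ffun 'I_n -> Y}) `|S y ^+ 2 - T y ^+ 2| <=
    \sum_(y : {ffun 'I_n -> Y}) ((S y ^+ 2 + T y ^+ 2 - 2 * (S y * T y)) / (2 * t)
       + t / 2 * (2 * (S y ^+ 2) + 2 * T y ^+ 2)).
  apply: ler_sum => y _.
  have := sqrtr_ge0 (\prod_i P i (y i)); have := sqrtr_ge0 (\prod_i Q i (y i)).
  rewrite -/(S y) -/(T y); move: (S y) (T y) => s r r0 s0.
  rewrite subr_sqr normrM (ger0_norm (addr_ge0 s0 r0)) -subr_ge0.
  have -> : (s ^+ 2 + r ^+ 2 - 2 * (s * r)) = `|s - r| ^+ 2.
    by rewrite real_normK ?num_real//; ring.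
  rewrite (_ : _ - _ = (`|s - r| - t * (s + r)) ^+ 2 / (2 * t) +
      t / 2 * (s - r) ^+ 2); last by field; rewrite gt_eqF.
  have t0' := ltW t0.
  by apply: addr_ge0; apply: mulr_ge0;
    rewrite ?sqr_ge0 ?invr_ge0 ?divr_ge0 ?mulr_ge0.
under eq_bigr => y _ do rewrite -(sqr_sqrtr (prodP0 y)) -(sqr_sqrtr (prodQ0 y)).
apply: le_trans main _.
rewrite big_split/= -mulr_suml -mulr_sumr !big_split/= sumrN -!mulr_sumr S2 T2 ST.
rewrite (_ : t / 2 * (2 * 1 + 2 * 1) = 2 * t); last by field.
rewrite lerD2r ler_wpM2r ?invr_ge0 ?mulr_ge0//; first lra.
rewrite (eq_bigr _ (fun i _ => bcE i)) -mulr_sumr.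
have := prod_one_sub_le bc01; lra.
Qed.

(** * Sums along injections and total variation *)

Lemma sum_inj_le (R : numDomainType) (A B : finType) (f : A -> B) (F : B -> R) :
  injective f -> (forall b, 0 <= F b) -> \sum_a F (f a) <= \sum_b F b.
Proof.
move=> f_inj F0.
have -> : \sum_a F (f a) = \sum_(b in f @: [set: A]) F b.
  rewrite big_imset/=; last by move=> ? ? _ _; exact: f_inj.
  by apply: eq_bigl => a; rewrite inE.
by rewrite [leRHS](bigID (mem (f @: [set: A])))/= lerDl sumr_ge0.
Qed.

Lemma pmf_le1 (R : realType) (A : finType) (p : dist R A) (a : A) : p a <= 1.
Proof.
rewrite -(pmf_sum1 p) (bigD1 a)//= lerDl; apply: sumr_ge0 => b _.
exact: (Defs.pmf_ge0 p b).
Qed.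

(** Both laws have mass 1, so adding [(p a - q a) / 2] to each [|p a - q a| / 2] leaves the sum
    unchanged. *)
Lemma dTV_pos_part (R : realType) (A : finType) (p q : dist R A) :
  dTV p q = \sum_a Num.max (p a - q a) 0.
Proof.
have pq0 : \sum_a 2^-1 * (q a - p a) = 0.
  by rewrite -mulr_sumr sumrB !pmf_sum1 subrr mulr0.
rewrite /dTV mulr_sumr -[RHS]addr0 -[X in _ + X]pq0 -big_split/=.
apply: eq_bigr => a _.
by case: (leP 0 (p a - q a)) => h; [rewrite ger0_norm//|rewrite ltr0_norm//]; lra.
Qed.

(** * Re-randomizing one coordinate under a uniform prior *)

(** Packing block and new value into one index [x] lets a single sum run over all [m * M]
    one-coordinate changes, trivial ones included. *)
Definition set_coord (m M : nat) (z : {ffun 'I_m -> 'I_M}) (x : 'I_m * 'I_M) :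
  {ffun 'I_m -> 'I_M} := [ffun b => if b == x.1 then x.2 else z b].

(** The value overwritten at [x.1] is forgotten, so each assignment with value [x.2] there has
    exactly [M] preimages. *)
Lemma sum_set_coord (R : pzSemiRingType) (m M : nat) (x : 'I_m * 'I_M)
    (F : {ffun 'I_m -> 'I_M} -> R) :
  \sum_z F (set_coord z x) = (\sum_(z : {ffun 'I_m -> 'I_M}) (z x.1 == x.2)%:R * F z) *+ M.
Proof.
case: x => b j /=.
(* [(z, i) |-> (z with z_b := i, z_b)] is an involution. *)
pose sw (u : {ffun 'I_m -> 'I_M} * 'I_M) := (set_coord u.1 (b, u.2), u.1 b).
have swK : involutive sw.
  move=> [z i]; rewrite /sw /= /set_coord/= ffunE eqxx; congr (_, _).
  by apply/ffunP => c; rewrite !ffunE/=; case: eqP => // ->.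
(* The dummy [i], pinned to [j], makes this a sum over pairs, on which [sw] acts. *)
transitivity (\sum_z \sum_(i < M) (i == j)%:R * F (set_coord z (b, i))).
  apply: eq_bigr => z _; rewrite (bigD1 j)//= eqxx mul1r big1 ?addr0// => i /negPf->.
  by rewrite mul0r.
rewrite pair_bigA/= (reindex_inj (inv_inj swK))/=.
rewrite -sumrMnl -(pair_bigA _ (fun (z : {ffun 'I_m -> 'I_M}) i =>
  (z b == j)%:R * F (set_coord (set_coord z (b, i)) (b, z b))))/=.
apply: eq_bigr => z _.
rewrite (eq_bigr (fun=> (z b == j)%:R * F z)) ?sumr_const ?card_ord// => i _.
congr (_ * F _).
by apply/ffunP => c; rewrite !ffunE/=; case: eqP => // ->.
Qed.

(* Under a uniform prior, restricting to [z_b = j] and then re-randomizing [z_b]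
   costs only the distance between the two laws of the observation. *)
Lemma coord_event_ge (R : realFieldType) (m M : nat) (O : finType)
    (P : {ffun 'I_m -> 'I_M} -> O -> R) (x : 'I_m * 'I_M) (d : O -> R) (D : R) :
  (0 < M)%N -> (forall o, `|d o| <= D) ->
  M%:R^-1 * (\sum_z \sum_o P z o * d o)
    - D / M%:R * \sum_z \sum_o `|P z o - P (set_coord z x) o|
  <= \sum_(z : {ffun 'I_m -> 'I_M}) \sum_o P z o * ((z x.1 == x.2)%:R * d o).
Proof.
move=> M0 dD.
have M0' : 0 < M%:R^-1 :> R by rewrite invr_gt0 ltr0n.
have -> : \sum_(z : {ffun 'I_m -> 'I_M}) \sum_o P z o * ((z x.1 == x.2)%:R * d o) =
    M%:R^-1 * \sum_z \sum_o P (set_coord z x) o * d o.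
  rewrite (sum_set_coord x (fun z => \sum_o P z o * d o)) -[X in _ * X]mulr_natl mulrA mulVf.
    rewrite mul1r; apply: eq_bigr => z _; rewrite mulr_sumr.
    by apply: eq_bigr => o _; rewrite mulrCA.
  by rewrite pnatr_eq0 -lt0n.
rewrite (mulrC D) -mulrA -mulrBr ler_pM2l// mulr_sumr -sumrB; apply: ler_sum => z _.
rewrite mulr_sumr -sumrB; apply: ler_sum => o _.
rewrite lerBlDr -lerBlDl -mulrBl.
by apply: le_trans (ler_norm _) _; rewrite normrM mulrC ler_wpM2r.
Qed.

(** The loss is affine in the indicators [z x.1 == x.2]. Replacing each by its prior mean [1 / M]
    costs [D / M] times a distance, in all at most [D * m * delta] per [z]; what remains is at least
    [L] for every observation. *)
Lemma bayes_risk_ge (R : realFieldType) (m M : nat) (O : finType)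
    (P : {ffun 'I_m -> 'I_M} -> O -> R)
    (base d : 'I_m * 'I_M -> O -> R) (D L delta : R) :
  (0 < M)%N -> 0 <= D ->
  (forall z o, 0 <= P z o) -> (forall z, \sum_o P z o = 1) ->
  (forall x o, `|d x o| <= D) ->
  (forall o, L <= \sum_x (base x o + M%:R^-1 * d x o)) ->
  (forall z, \sum_x \sum_o `|P z o - P (set_coord z x) o| <= delta * (m * M)%:R) ->
  #|{ffun 'I_m -> 'I_M}|%:R * (L - D * m%:R * delta) <=
    \sum_(z : {ffun 'I_m -> 'I_M})
      \sum_o P z o * \sum_x (base x o + (z x.1 == x.2)%:R * d x o).
Proof.
move=> M0 D0 P0 P1 dD leL le_delta.
have M0' : (0 : R) < M%:R by rewrite ltr0n.
have -> : \sum_(z : {ffun 'I_m -> 'I_M})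
    \sum_o P z o * \sum_x (base x o + (z x.1 == x.2)%:R * d x o) =
   \sum_z \sum_o P z o * (\sum_x base x o) +
   \sum_x \sum_(z : {ffun 'I_m -> 'I_M}) \sum_o P z o * ((z x.1 == x.2)%:R * d x o).
  rewrite [X in _ + X]exchange_big/= -big_split/=; apply: eq_bigr => z _.
  rewrite [X in _ + X]exchange_big/= -big_split/=; apply: eq_bigr => o _.
  by rewrite -mulr_sumr -mulrDr -big_split.
apply: (@le_trans _ _ (\sum_z \sum_o P z o * (\sum_x base x o) +
   \sum_x (M%:R^-1 * (\sum_z \sum_o P z o * d x o)
    - D / M%:R * \sum_z \sum_o `|P z o - P (set_coord z x) o|))); last first.
  by rewrite lerD2l; apply: ler_sum => x _; exact: coord_event_ge.
rewrite sumrB addrA mulrBr; apply: lerB.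
  rewrite -mulr_sumr [X in M%:R^-1 * X]exchange_big/= mulr_sumr -big_split/=.
  rewrite mulr_natl -sumr_const; apply: ler_sum => z _.
  rewrite [X in M%:R^-1 * X]exchange_big/= mulr_sumr -big_split/=.
  rewrite -[L]mul1r -[X in X * L](P1 z) mulr_suml.
  apply: ler_sum => o _.
  rewrite -mulr_sumr mulrCA -mulrDr ler_wpM2l//.
  rewrite mulr_sumr -big_split/=; exact: leL.
rewrite -mulr_sumr exchange_big/=.
rewrite (_ : #|_|%:R * (D * m%:R * delta) =
  D / M%:R * (\sum_(z : {ffun 'I_m -> 'I_M}) delta * (m * M)%:R)); last first.
  by rewrite sumr_const -[_ *+ #|_|]mulr_natl natrM; field; rewrite gt_eqF.
by rewrite ler_wpM2l ?divr_ge0 ?(ltW M0')//; apply: ler_sum => z _.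
Qed.

(** Serves to turn a lower bound on the risk into one on the error probability. *)
Lemma loss_le (R : realFieldType) (O : finType) (P G : O -> R) (bad : pred O)
    (eps B : R) :
  (forall o, 0 <= P o) -> \sum_o P o = 1 -> 0 <= eps ->
  (forall o, G o <= B) -> (forall o, ~~ bad o -> G o <= eps) ->
  \sum_o P o * G o <= eps + B * \sum_(o | bad o) P o.
Proof.
move=> P0 P1 eps0 GB Geps.
rewrite -[eps]mul1r -P1 mulr_suml mulr_sumr [leRHS]addrC [X in X + _]big_mkcond/= -big_split/=.
apply: ler_sum => o _; case: ifPn => bo.
  by rewrite addrC -[leLHS]add0r lerD ?mulr_ge0// mulrC ler_wpM2r.
by rewrite add0r ler_wpM2l// Geps.
Qed.

(** * Law of the messages *)

Definition output_pmf (R : realType) (k : nat) (Y : finType)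
  (W : channel R k Y) (p : dist R 'I_k) (y : Y) : R := \sum_x p x * W x y.

Lemma output_pmf_ge0 (R : realType) (k : nat) (Y : finType)
  (W : channel R k Y) (p : dist R 'I_k) (y : Y) : 0 <= output_pmf W p y.
Proof. by apply: sumr_ge0 => x _; rewrite mulr_ge0// Defs.pmf_ge0. Qed.

Lemma sum_output_pmf (R : realType) (k : nat) (Y : finType)
  (W : channel R k Y) (p : dist R 'I_k) : \sum_y output_pmf W p y = 1.
Proof.
rewrite exchange_big/= -(pmf_sum1 p); apply: eq_bigr => x _.
by rewrite -mulr_sumr pmf_sum1 mulr1.
Qed.

(** Given the coin, the messages are independent: the samples are summed out by distributivity. *)
Lemma sum_transcript_pmf (R : realType) (k : nat) (Y : finType) (n : nat)
    (W : 'I_n -> channel R k Y) (p : dist R 'I_k) (bad : pred {ffun 'I_n -> Y}) :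
  \sum_x \sum_(y | bad y) transcript_pmf W p x y =
    \sum_(y | bad y) \prod_i output_pmf (W i) p (y i).
Proof. by rewrite exchange_big/=; apply: eq_bigr => y _; rewrite bigA_distr_bigA. Qed.

(** * Spiked distributions and their channel outputs *)

(** For injective [e], this is the indicator of the chosen points. As [e] need not be onto, [k] may
    exceed [m * M]. *)
Definition spike (m M k : nat) (e : 'I_m * 'I_M -> 'I_k)
  (z : {ffun 'I_m -> 'I_M}) (x : 'I_k) : nat := \sum_b (x == e (b, z b)).

Lemma spike_e (m M k : nat) (e : 'I_m * 'I_M -> 'I_k) z b j :
  injective e -> spike e z (e (b, j)) = (z b == j).
Proof.
move=> e_inj; rewrite /spike (bigD1 b)//= big1 ?addn0 => [|c /negPf cb].
  by rewrite (inj_eq e_inj) xpair_eqE eqxx eq_sym.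
by rewrite (inj_eq e_inj) xpair_eqE eq_sym cb.
Qed.

Lemma sum_spike (R : pzRingType) (m M k : nat) (e : 'I_m * 'I_M -> 'I_k) z
    (F : 'I_k -> R) :
  \sum_x (spike e z x)%:R * F x = \sum_b F (e (b, z b)).
Proof.
under eq_bigr => x _ do rewrite natr_sum mulr_suml.
rewrite exchange_big/=; apply: eq_bigr => b _.
rewrite (bigD1 (e (b, z b)))//= eqxx mul1r big1 ?addr0// => x /negPf->.
by rewrite mul0r.
Qed.

Definition spiked_pmf (R : realType) (m M k : nat) (e : 'I_m * 'I_M -> 'I_k)
  (g : R) (z : {ffun 'I_m -> 'I_M}) (x : 'I_k) : R :=
  (1 - g) / k%:R + g / m%:R * (spike e z x)%:R.

Lemma spiked_pmf_ge0 (R : realType) (m M k : nat) (e : 'I_m * 'I_M -> 'I_k)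
    (g : R) z x : 0 <= g <= 1 -> 0 <= spiked_pmf e g z x.
Proof.
by case/andP=> g0 g1; rewrite addr_ge0// ?mulr_ge0 ?invr_ge0 ?subr_ge0 ?ler0n.
Qed.

Lemma spiked_pmf_sum1 (R : realType) (m M k : nat) (e : 'I_m * 'I_M -> 'I_k)
    (g : R) z : (0 < m)%N -> (0 < k)%N -> \sum_x spiked_pmf e g z x = 1.
Proof.
move=> m0 k0; rewrite big_split/= sumr_const card_ord -mulr_sumr.
have -> : \sum_x (spike e z x)%:R = m%:R :> R.
  under eq_bigr => x _ do rewrite -[_%:R]mulr1.
  by rewrite (sum_spike e z (fun=> 1)) sumr_const card_ord.
rewrite -[_ *+ k]mulr_natr.
rewrite !divfK ?pnatr_eq0 -?lt0n//; ring.
Qed.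

Definition spiked_dist (R : realType) (m M k : nat) (e : 'I_m * 'I_M -> 'I_k)
    (g : R) (g01 : 0 <= g <= 1) (m0 : (0 < m)%N) (k0 : (0 < k)%N)
    (z : {ffun 'I_m -> 'I_M}) : dist R 'I_k :=
  Dist (fun x => spiked_pmf_ge0 e z x g01) (spiked_pmf_sum1 e g z m0 k0).

Lemma output_spiked (R : realType) (m M k : nat) (Y : finType)
    (e : 'I_m * 'I_M -> 'I_k) (g : R) g01 m0 k0 z (W : channel R k Y) (y : Y) :
  output_pmf W (spiked_dist e (g:=g) g01 m0 k0 z) y =
  (1 - g) / k%:R * (\sum_x W x y) + g / m%:R * \sum_b W (e (b, z b)) y.
Proof.
rewrite -(sum_spike e z (fun x => W x y)) !mulr_sumr -big_split/=.
by apply: eq_bigr => x _; rewrite mulrA -mulrDl.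
Qed.

(** Fix [y] and let [S] be the sum of [W x y] over [x]. The output probability is at least [lo * S],
    and a coordinate change moves it by [D] times a difference of two entries of [W]. The squared
    moves sum to at most [D^2 (M + 1) S], so [S] cancels on division by [lo * S]: every [y] gets the
    same bound, whatever the channel. *)
Lemma output_spiked_hellinger (R : realType) (m M k : nat) (Y : finType)
    (e : 'I_m * 'I_M -> 'I_k) (g : R) g01 m0 k0 z (W : channel R k Y) :
  injective e -> g < 1 ->
  \sum_x \sum_y (Num.sqrt (output_pmf W (spiked_dist e (g:=g) g01 m0 k0 z) y)
     - Num.sqrt (output_pmf W (spiked_dist e (g:=g) g01 m0 k0 (set_coord z x)) y))
     ^+ 2 <=
  #|Y|%:R * ((g / m%:R) ^+ 2 * M.+1%:R / ((1 - g) / k%:R)).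
Proof.
move=> e_inj g1; set p := spiked_dist e g01 m0 k0.
rewrite exchange_big/= mulr_natl -sumr_const.
apply: ler_sum => y _.
set lo := (1 - g) / k%:R; set D := g / m%:R; pose S := \sum_x W x y.
have lo0 : 0 < lo by rewrite divr_gt0 ?subr_gt0 ?ltr0n.
have W0 x : 0 <= W x y by exact: Defs.pmf_ge0.
have S0 : 0 <= S by exact: sumr_ge0.
have oE z' : output_pmf W (p z') y = lo * S + D * \sum_b W (e (b, z' b)) y.
  exact: output_spiked.
have g0 : 0 <= g by have /andP[] := g01.
have D0 : 0 <= D by rewrite divr_ge0.
have o0 z' : 0 <= output_pmf W (p z') y by exact: output_pmf_ge0.
have oS z' : lo * S <= output_pmf W (p z') y.
  by rewrite oE lerDl mulr_ge0 ?sumr_ge0.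
have sub b j : output_pmf W (p z) y - output_pmf W (p (set_coord z (b, j))) y =
    D * (W (e (b, z b)) y - W (e (b, j)) y).
  rewrite !oE opprD addrACA subrr add0r -mulrBr; congr (_ * _).
  rewrite (bigD1 b)//= [in X in _ - X](bigD1 b)//= ffunE eqxx opprD addrACA.
  rewrite [X in _ + (X - _)](_ : _ = \sum_(c < m | c != b) W (e (c, set_coord z (b, j) c)) y).
    by rewrite subrr addr0.
  by apply: eq_bigr => c /negPf cb; rewrite ffunE/= cb.
have le1 b j : (Num.sqrt (output_pmf W (p z) y)
     - Num.sqrt (output_pmf W (p (set_coord z (b, j))) y)) ^+ 2 * (lo * S) <=
     D ^+ 2 * (W (e (b, z b)) y + W (e (b, j)) y).
  apply: (@le_trans _ _ ((output_pmf W (p z) y -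
      output_pmf W (p (set_coord z (b, j))) y) ^+ 2)).
    by apply: le_trans (sqr_sqrt_sub_le _ _); rewrite ?ler_wpM2l ?sqr_ge0.
  (* Entries [u], [v] in [[0, 1]] satisfy [(u - v)^2 <= u + v]. *)
  rewrite sub exprMn ler_wpM2l ?sqr_ge0//.
  have := W0 (e (b, z b)); have := W0 (e (b, j)).
  have := pmf_le1 (W (e (b, z b))) y; have := pmf_le1 (W (e (b, j))) y.
  by nra.
(* If [S = 0], no input yields [y] and both output probabilities vanish. *)
have [S_eq0|S_neq0] := eqVneq S 0.
  rewrite big1 => [|[b j] _].
    by rewrite !mulr_ge0 ?invr_ge0 ?ler0n ?sqr_ge0 ?(ltW lo0).
  apply/eqP; rewrite sqrf_eq0 subr_eq0 !oE S_eq0 mulr0 !add0r.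
  have WS0 x : W x y = 0.
    apply/eqP; move/eqP: S_eq0; rewrite psumr_eq0// => /allP/(_ x).
    by rewrite mem_index_enum; apply.
  by rewrite !big1.
have S_gt0 : 0 < S by rewrite lt0r S_neq0.
rewrite -(ler_pM2r (mulr_gt0 lo0 S_gt0)) mulr_suml.
rewrite (_ : _ * (lo * S) = D ^+ 2 * (M%:R * S + S)); last first.
  by rewrite -[M.+1]addn1 natrD; field; rewrite gt_eqF.
apply: (@le_trans _ _ (\sum_(x : 'I_m * 'I_M) D ^+ 2 * (W (e (x.1, z x.1)) y + W (e x) y))).
  by apply: ler_sum => -[b j] _; exact: le1.
(* Each [W (e (b, z b)) y] occurs once per value [j], giving at most [M * S]; the terms [W (e x) y]
   give at most [S]. *)
rewrite -mulr_sumr ler_wpM2l ?sqr_ge0// big_split/= lerD//; last exact: sum_inj_le.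
rewrite -(pair_bigA _ (fun b j => W (e (b, z b)) y))/=.
under eq_bigr => b _ do rewrite sumr_const card_ord -[_ *+ M]mulr_natl.
rewrite -mulr_sumr ler_wpM2l//.
apply: (@sum_inj_le _ _ _ (fun b => e (b, z b)) (fun x => W x y)) => //.
by move=> b c /e_inj [].
Qed.

(** * Error lower bound for a fixed coin value *)

(* [f] is the loss at a point as a function of [p - q]: it moves by at most [D]
   when the point becomes a spike, and [L] is the average loss of a blind guess. *)
Lemma spiked_error_ge (R : realType) (m M k : nat) (Y : finType) (n : nat)
    (e : 'I_m * 'I_M -> 'I_k) (g : R) g01 m0 k0 (W : 'I_n -> channel R k Y)
    (phat : {ffun 'I_n -> Y} -> dist R 'I_k) (f : R -> R) (D L B eps : R) :
  injective e -> g < 1 -> (0 < M)%N -> 0 <= D -> 0 <= eps ->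
  (forall s, `|f (s + g / m%:R) - f s| <= D) ->
  (forall p q : dist R 'I_k, \sum_x f (p (e x) - q (e x)) <= Num.min (dTV q p) B) ->
  (forall q : dist R 'I_k, L <= \sum_x (f ((1 - g) / k%:R - q (e x)) + M%:R^-1 *
     (f ((1 - g) / k%:R - q (e x) + g / m%:R) - f ((1 - g) / k%:R - q (e x))))) ->
  n%:R * #|Y|%:R * ((g / m%:R) ^+ 2 * M.+1%:R / ((1 - g) / k%:R)) <=
    (m * M)%:R / 144 ->
  #|{ffun 'I_m -> 'I_M}|%:R * (L - D * m%:R / 6) <=
    #|{ffun 'I_m -> 'I_M}|%:R * eps +
    B * \sum_z \sum_(x : {ffun 'I_n -> 'I_k})
      \sum_(y | eps < dTV (phat y) (spiked_dist e (g:=g) g01 m0 k0 z))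
      transcript_pmf W (spiked_dist e (g:=g) g01 m0 k0 z) x y.
Proof.
move=> e_inj g1 M0 D0 eps0 fD fG fL small; set p := spiked_dist e g01 m0 k0.
set lo := (1 - g) / k%:R.
pose P z (y : {ffun 'I_n -> Y}) := \prod_i output_pmf (W i) (p z) (y i).
pose base x y := f (lo - phat y (e x)).
pose d x y := f (lo - phat y (e x) + g / m%:R) - f (lo - phat y (e x)).
have P0 z y : 0 <= P z y by apply: prodr_ge0 => i _; exact: output_pmf_ge0.
have P1 z : \sum_y P z y = 1.
  rewrite -(bigA_distr_bigA (fun i => output_pmf (W i) (p z)))/= big1// => i _.
  exact: sum_output_pmf.
have lossE (z : {ffun 'I_m -> 'I_M}) y : \sum_x (base x y + (z x.1 == x.2)%:R * d x y) =
    \sum_x f (p z (e x) - phat y (e x)).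
  apply: eq_bigr => -[b j] _; rewrite /base /d /= /spiked_pmf spike_e// -/lo.
  case: eqP => _; last by rewrite mul0r mulr0 !addr0.
  by rewrite mul1r mulr1 addrCA subrr addr0 addrAC.
(* The Bayes risk for uniform [z] is the middle term: [bayes_risk_ge] with [delta = 1 / 6] bounds it
   below, [loss_le] above. *)
apply: le_trans (_ : _ <= \sum_z \sum_y P z y * \sum_x f (p z (e x) - phat y (e x))) _.
  under eq_bigr => z _ do under eq_bigr => y _ do rewrite -lossE.
  rewrite -[D * _ / 6]/(D * m%:R * 6^-1); apply: bayes_risk_ge => //.
    by move=> x y; exact: fD.
    by move=> y; exact: fL.
  move=> z.
  (* With [t = 1 / 24] the two terms are balanced: each totals at most [m M / 12]. *)
  apply: (@le_trans _ _ (\sum_(x : 'I_m * 'I_M) ((\sum_i \sum_y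
      (Num.sqrt (output_pmf (W i) (p z) y) -
       Num.sqrt (output_pmf (W i) (p (set_coord z x)) y)) ^+ 2) / (2 * 24^-1) + 2 * 24^-1))).
    apply: ler_sum => x _; apply: sum_dist_prod_le => // *;
      by rewrite ?output_pmf_ge0 ?sum_output_pmf.
  rewrite big_split/= sumr_const card_prod !card_ord -mulr_suml exchange_big/=.
  rewrite -[X in _ + X]mulr_natr.
  have : \sum_(i < n) \sum_x \sum_y
     (Num.sqrt (output_pmf (W i) (p z) y) -
       Num.sqrt (output_pmf (W i) (p (set_coord z x)) y)) ^+ 2 <= (m * M)%:R / 144.
    apply: le_trans small; rewrite -mulrA mulr_natl -[X in _ *+ X]card_ord -sumr_const.
    by apply: ler_sum => i _; exact: output_spiked_hellinger.
  set S := \sum_(i < n) _; set mM := (m * M)%:R => SmM.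
  have -> : 6^-1 * mM = mM / 144 / (2 * 24^-1) + 2 * 24^-1 * mM by field.
  by rewrite lerD2r ler_wpM2r ?invr_ge0.
rewrite mulr_natl -sumr_const mulr_sumr -big_split/=; apply: ler_sum => z _.
rewrite sum_transcript_pmf; apply: loss_le => // y.
  by have := fG (p z) (phat y); rewrite le_min => /andP[].
by rewrite -leNgt; apply: le_trans; have := fG (p z) (phat y); rewrite le_min => /andP[].
Qed.

(** * Averaging over the public coin *)

Lemma measurable_error (R : realType) (k : nat) (Y : finType)
    (F : set (channel R k Y)) (n : nat) (Pi : public_coin_protocol F n)
    (phat : referee Pi) (eps : R) (p : dist R 'I_k) :
  measurable_fun [set: coin Pi] (fun u =>
    \sum_(x : {ffun 'I_n -> 'I_k})
     \sum_(y : {ffun 'I_n -> Y} | eps < dTV (phat u y) p)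
       transcript_pmf (chan u) p x y).
Proof.
apply: measurable_sum => x; under eq_fun do rewrite big_mkcond/=.
apply: measurable_sum => y; apply: measurable_fun_ifT => //.
  apply: measurable_fun_ltr => //; apply: measurable_funM => //.
  apply: measurable_sum => a; apply: measurableT_comp => //.
  by apply: measurable_funB => //; exact: estimate_measurable.
apply: measurable_prod => i _; apply: measurable_funM => //.
exact: chan_measurable.
Qed.

(** Exchanging the finite sum with the integral: if the errors average at least [1 / 12] over [z]
    for every coin value, some [p z] has error at least [1 / 12]. *)
Lemma not_estimator (R : realType) (k : nat) (Y : finType)
    (F : set (channel R k Y)) (n : nat) (Pi : public_coin_protocol F n)
    (phat : referee Pi) (eps : R) (Z : finType) (p : Z -> dist R 'I_k) :
  (0 < #|Z|)%N ->
  (forall u : coin Pi, #|Z|%:R / 12 <= \sum_z \sum_(x : {ffun 'I_n -> 'I_k})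
     \sum_(y : {ffun 'I_n -> Y} | eps < dTV (phat u y) (p z))
       transcript_pmf (chan u) (p z) x y) ->
  ~ public_coin_estimator eps phat.
Proof.
move=> Z0 err_ge est.
pose err u z := \sum_(x : {ffun 'I_n -> 'I_k})
     \sum_(y : {ffun 'I_n -> Y} | eps < dTV (phat u y) (p z))
       transcript_pmf (chan u) (p z) x y.
have err0 u z : 0 <= err u z.
  apply: sumr_ge0 => x _; apply: sumr_ge0 => y _; apply: prodr_ge0 => i _.
  by rewrite mulr_ge0 ?Defs.pmf_ge0.
have merr z : measurable_fun [set: coin Pi] (fun u => err u z).
  exact: measurable_error.
have : (\sum_z error_probability phat eps (p z) < \sum_(z : Z) (12^-1)%:E)%E.
  have fin z : error_probability phat eps (p z) \is a fin_num.
    rewrite ge0_fin_numE ?(lt_trans (est (p z)) (ltry _))//.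
    by apply: integral_ge0 => u _; rewrite lee_fin; exact: err0.
  under eq_bigr => z _ do rewrite -(fineK (fin z)).
  rewrite !sumEFin lte_fin; apply: ltr_sum => [|z _].
    by move: Z0; rewrite cardT enumT has_predT.
  by rewrite -lte_fin fineK.
apply/negP; rewrite -leNgt.
have -> : (\sum_z error_probability phat eps (p z) =
    \int[coin_law Pi]_u (\sum_z (err u z)%:E))%E.
  rewrite ge0_integral_sum//.
    by move=> z; apply/measurable_EFinP.
  by move=> z u _; rewrite lee_fin.
rewrite sumEFin sumr_const -[_ *+ _]mulr_natl.
have -> : (#|Z|%:R * 12^-1 : R)%:E = (\int[coin_law Pi]_u (#|Z|%:R / 12 : R)%:E)%E.
  by rewrite integral_cst// [X in (_ * X)%E]probability_setT mule1.
apply: ge0_le_integral => //.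
- by apply: emeasurable_sum => z; apply/measurable_EFinP.
- by move=> u _; rewrite sumEFin lee_fin; exact: err_ge.
Qed.

(** * The two loss functions *)

(* The loss is capped at [D] per point so that its total stays below [4 * eps];
   with an uncapped loss the error event could cost up to [1]. *)
Lemma spiked_error_ge_small (R : realType) (m k : nat) (Y : finType) (n : nat)
    (e : 'I_m * 'I_2 -> 'I_k) (eps : R) g01 m0 k0 (W : 'I_n -> channel R k Y)
    (phat : {ffun 'I_n -> Y} -> dist R 'I_k) :
  injective e -> 0 < eps -> 4 * eps < 1 ->
  n%:R * #|Y|%:R * ((4 * eps / m%:R) ^+ 2 * 3 / ((1 - 4 * eps) / k%:R)) <=
    (m * 2)%:R / 144 ->
  #|{ffun 'I_m -> 'I_2}|%:R / 12 <=
    \sum_z \sum_(x : {ffun 'I_n -> 'I_k})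
      \sum_(y | eps < dTV (phat y) (spiked_dist e (g:=4 * eps) g01 m0 k0 z))
      transcript_pmf W (spiked_dist e (g:=4 * eps) g01 m0 k0 z) x y.
Proof.
move=> e_inj eps0 eps4 small.
set D := 2 * eps / m%:R.
have m0' : 0 < m%:R :> R by rewrite ltr0n.
have D0 : 0 <= D by rewrite divr_ge0 ?mulr_ge0 ?ltW.
have gD : 4 * eps / m%:R = 2 * D by rewrite /D; field; rewrite gt_eqF.
have mD : D * m%:R = 2 * eps by rewrite /D divfK// gt_eqF.
have N0 := ler0n R #|{ffun 'I_m -> 'I_2}|.
(* Here [L = m D = 2 eps] and [B = 2 m D = 4 eps]; dividing by [4 eps] leaves an average error of at
   least [1 / 6]. *)
suff : #|{ffun 'I_m -> 'I_2}|%:R * (2 * eps - D * m%:R / 6) <=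
    #|{ffun 'I_m -> 'I_2}|%:R * eps + 4 * eps *
    \sum_z \sum_(x : {ffun 'I_n -> 'I_k})
      \sum_(y | eps < dTV (phat y) (spiked_dist e (g:=4 * eps) g01 m0 k0 z))
      transcript_pmf W (spiked_dist e (g:=4 * eps) g01 m0 k0 z) x y.
  rewrite mD; set N := #|_|%:R in N0 *; set S := \sum_z _ => h.
  rewrite -(ler_pM2l (mulr_gt0 (ltr0n R 4) eps0)); have := mulr_ge0 N0 (ltW eps0); lra.
apply: (@spiked_error_ge _ _ _ _ _ _ _ _ _ _ _ W phat
  (fun s => Num.min (`|s| / 2) D) D) => // [|s|p q|q].
- exact: ltW.
- by case: (ltP (`|s + _| / 2) D) => h1; case: (ltP (`|s| / 2) D) => h2;
    rewrite ?subrr ?normr0// ler_norml; apply/andP; split; have := normr_ge0 s;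
    have := normr_ge0 (s + 4 * eps / m%:R); lra.
- rewrite le_min; apply/andP; split.
    rewrite /dTV mulr_sumr.
    apply: le_trans (sum_inj_le e_inj (F := fun x => 2^-1 * `|q x - p x|) _) => [|x].
      by apply: ler_sum => x _; rewrite distrC mulrC ge_min lexx.
    by rewrite mulr_ge0.
  apply: (@le_trans _ _ (\sum_(x : 'I_m * 'I_2) D)).
    by apply: ler_sum => x _; rewrite ge_min lexx orbT.
  by rewrite sumr_const card_prod !card_ord -[leLHS]mulr_natr natrM mulrA mD; lra.
(* For [M = 2] the summand is the mean of the losses at [s] and [s + 2 D]; as
   [|s| + |s + 2 D| >= 2 D], it is at least [D / 2] despite the cap. *)
- apply: (@le_trans _ _ (\sum_(x : 'I_m * 'I_2) D / 2)).
    by rewrite sumr_const card_prod !card_ord -[leRHS]mulr_natr natrM mulrAC mulrA mD; lra.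
  apply: ler_sum => x _; rewrite gD; set s := _ - _.
  have := ler_norm (s + 2 * D); have := ler_norm (- s); rewrite normrN.
  have := normr_ge0 s; have := normr_ge0 (s + 2 * D).
  by case: (ltP (`|s + _| / 2) D) => h1; case: (ltP (`|s| / 2) D) => h2; lra.
Qed.

Lemma dTV_sym (R : realType) (A : finType) (p q : dist R A) : dTV p q = dTV q p.
Proof. by rewrite /dTV; under eq_bigr do rewrite distrC. Qed.

(* Keeping only the positive parts [(p - q)_+] loses nothing in [dTV], and lets
   the lower bound use that the guess [q] has total mass [1]. *)
Lemma spiked_error_ge_large (R : realType) (m k : nat) (Y : finType) (n : nat)
    (e : 'I_m * 'I_8 -> 'I_k) (eps : R) (g01 : (0 : R) <= 7 / 8 <= 1) m0 k0
    (W : 'I_n -> channel R k Y)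
    (phat : {ffun 'I_n -> Y} -> dist R 'I_k) :
  injective e -> 0 < eps -> eps < 2^-1 ->
  n%:R * #|Y|%:R * ((7 / 8 / m%:R) ^+ 2 * 9 / ((1 - 7 / 8) / k%:R)) <=
    (m * 8)%:R / 144 :> R ->
  #|{ffun 'I_m -> 'I_8}|%:R / 12 <=
    \sum_z \sum_(x : {ffun 'I_n -> 'I_k})
      \sum_(y | eps < dTV (phat y) (spiked_dist e (g:=7 / 8) g01 m0 k0 z))
      transcript_pmf W (spiked_dist e (g:=7 / 8) g01 m0 k0 z) x y.
Proof.
move=> e_inj eps0 eps2 small.
set D : R := 7 / 8 / m%:R.
have m0' : 0 < m%:R :> R by rewrite ltr0n.
have D0 : 0 <= D by rewrite !divr_ge0 ?ltW.
have mD : D * m%:R = 7 / 8 by rewrite /D divfK// gt_eqF.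
have N0 := ler0n R #|{ffun 'I_m -> 'I_8}|.
(* [3 / 4 - 7 / 48 - 1 / 2 = 5 / 48] is just above [1 / 12]. *)
suff : #|{ffun 'I_m -> 'I_8}|%:R * (3 / 4 - D * m%:R / 6) <=
    #|{ffun 'I_m -> 'I_8}|%:R * eps + 1 *
    \sum_z \sum_(x : {ffun 'I_n -> 'I_k})
      \sum_(y | eps < dTV (phat y) (spiked_dist e (g:=7 / 8) g01 m0 k0 z))
      transcript_pmf W (spiked_dist e (g:=7 / 8) g01 m0 k0 z) x y.
  rewrite mD; set N := #|_|%:R in N0 *; set S := \sum_z _ => h.
  have : N * eps <= N * 2^-1 by rewrite ler_wpM2l// ltW.
  lra.
apply: (@spiked_error_ge _ _ _ _ _ _ _ _ _ _ _ W phat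
  (fun s => Num.max s 0) D) => // [||s|p q|q].
- lra.
- exact: ltW.
- rewrite -/D ler_norml; case: (leP 0 (s + D)) => h1; case: (leP 0 s) => h2; lra.
- rewrite le_min -(pmf_sum1 p) dTV_sym dTV_pos_part; apply/andP; split.
    apply: (sum_inj_le (F := fun x => Num.max (p x - q x) 0) e_inj) => x.
    by rewrite le_max lexx orbT.
  apply: le_trans (sum_inj_le (F := fun x => p x) e_inj _) => [|x]; last exact: Defs.pmf_ge0.
  by apply: ler_sum => x _; rewrite ge_max Defs.pmf_ge0 gerBl Defs.pmf_ge0.
rewrite -/D; set lo := _ / k%:R.
have lo0 : 0 <= lo by rewrite divr_ge0//; lra.
(* Only the spiked case, of weight [1 / 8], is kept, and [lo >= 0] is dropped. As [q] has mass at
   most 1 on the blocks, the total is at least [(8 m D - 1) / 8 = 3 / 4]. *)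
apply: (@le_trans _ _ (\sum_(x : 'I_m * 'I_8) 8^-1 * (D - q (e x)))).
  rewrite -mulr_sumr sumrB sumr_const card_prod !card_ord.
  have := sum_inj_le e_inj (Defs.pmf_ge0 q); rewrite pmf_sum1.
  by rewrite -[D *+ _]mulr_natr natrM mulrA mD; lra.
apply: ler_sum => x _; set s := q (e x).
by case: (leP 0 (lo - s + D)) => h1; case: (leP 0 (lo - s)) => h2; lra.
Qed.

(** * Excluding [n = 0] *)

Definition point_dist (R : realType) (A : finType) (a : A) : dist R A.
Proof.
refine (@Dist R A (fun x => (x == a)%:R) (fun=> ler0n _ _) _).
by rewrite (bigD1 a)//= eqxx big1 ?addr0// => x /negPf->.
Defined.

Lemma dTV_point (R : realType) (A : finType) (q : dist R A) (a : A) :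
  1 - q a <= dTV q (point_dist R a).
Proof.
rewrite dTV_sym dTV_pos_part (bigD1 a)//= eqxx.
apply: (@le_trans _ _ (Num.max (1 - q a) 0)); first by rewrite le_max lexx.
by rewrite lerDl sumr_ge0// => x _; rewrite le_max lexx orbT.
Qed.

(** The only transcript is empty, so given the coin the guess [q] is fixed; [q a + q b <= 1] puts it
    at distance at least [1 / 2] from one of two point masses. *)
Lemma no_sample_not_estimator (R : realType) (k : nat) (Y : finType)
    (F : set (channel R k Y)) (Pi : public_coin_protocol F 0)
    (phat : referee Pi) (eps : R) :
  (1 < k)%N -> eps < 2^-1 -> ~ public_coin_estimator eps phat.
Proof.
move=> k1 eps2; pose a := Ordinal (ltnW k1); pose b := Ordinal k1.
apply: (@not_estimator _ _ _ _ _ _ phat eps _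
  (fun z : bool => point_dist R (if z then a else b))); first by rewrite card_bool.
move=> u; rewrite big_bool/= !sum_transcript_pmf card_bool.
rewrite big_mkcond/= [X in _ + X]big_mkcond/= -big_split/=.
apply: (@le_trans _ _ (\sum_(y : {ffun 'I_0 -> Y}) (1 : R))).
  by rewrite sumr_const card_ffun card_ord expn0; lra.
apply: ler_sum => y _; rewrite !big_ord0.
set q := phat u y; have := dTV_point q a; have := dTV_point q b.
have : q a + q b <= 1.
  rewrite -(pmf_sum1 q) (bigD1 a)//= (bigD1 b)//= addrA lerDl sumr_ge0// => x _.
  exact: Defs.pmf_ge0.
by case: ltP => h1; case: ltP => h2; lra.
Qed.

(** * Choice of parameters and conclusion *)

Lemma exists_block_embedding (m M k : nat) : (m * M <= k)%N ->
  exists e : 'I_m * 'I_M -> 'I_k, injective e.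
Proof.
move=> mMk.
have h : (#|{: 'I_m * 'I_M}| <= k)%N by rewrite card_prod !card_ord.
exists (fun x => widen_ord h (enum_rank x)) => x y /(congr1 val)/= xy.
by apply: enum_rank_inj; exact: val_inj.
Qed.

(** [T] stands for the number of messages. The factor [1152 = 16 * 9 * 8] collects
    [g^2 <= 16 eps^2], [M + 1 <= 9] and [1 / (1 - g) <= 8]; [16^3] comes from [k <= 16 m], and [144]
    from the right-hand side. *)
Lemma small_information (R : realFieldType) (n k m M : nat) (T eps g c : R) :
  (0 < m)%N -> (0 < M <= 8)%N -> (0 < k <= 16 * m)%N ->
  0 <= c -> 144 * 1152 * 16 ^+ 3 * c <= 1 ->
  0 <= T -> 0 <= g -> g <= 4 * eps -> g <= 7 / 8 ->
  n%:R * T * eps ^+ 2 <= c * k%:R ^+ 2 ->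
  n%:R * T * ((g / m%:R) ^+ 2 * M.+1%:R / ((1 - g) / k%:R)) <=
    (m * M)%:R / 144.
Proof.
move=> m0 /andP[M0 M8] /andP[k0 km] c0 c_le T0 g0 geps g78 small.
have m0' : 0 < m%:R :> R by rewrite ltr0n.
have k0' : 0 < k%:R :> R by rewrite ltr0n.
have km' : k%:R <= 16 * m%:R :> R by rewrite -natrM ler_nat.
have M8' : M.+1%:R <= 9 :> R by rewrite ler_nat.
have M1' : 1 <= M%:R :> R by rewrite ler1n.
have nT0 : 0 <= n%:R * T by rewrite mulr_ge0.
have ng : n%:R * T * g ^+ 2 <= 16 * (c * k%:R ^+ 2).
  apply: (@le_trans _ _ (16 * (n%:R * T * eps ^+ 2))); last by rewrite ler_wpM2l.
  rewrite (_ : 16 * _ = n%:R * T * (4 * eps) ^+ 2); last by ring.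
  by rewrite ler_wpM2l// ler_sqr ?nnegrE// (le_trans g0).
have g1 : (1 - g)^-1 <= 8.
  by rewrite -[8]invrK lef_pV2 ?posrE ?invr_gt0//; lra.
have g1' : 0 <= (1 - g)^-1 by rewrite invr_ge0; lra.
have k3 : k%:R ^+ 3 <= (16 * m%:R) ^+ 3 :> R by rewrite lerXn2r ?nnegrE ?mulr_ge0 ?ler0n.
rewrite (_ : _ * _ =
  (n%:R * T * g ^+ 2) * k%:R * M.+1%:R * (1 - g)^-1 / m%:R ^+ 2); last first.
  by field; rewrite !gt_eqF//; lra.
apply: (@le_trans _ _ (16 * (c * k%:R ^+ 2) * k%:R * 9 * 8 / m%:R ^+ 2)).
  have ngk0 : 0 <= n%:R * T * g ^+ 2 * k%:R by rewrite !mulr_ge0 ?sqr_ge0 ?ler0n.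
  apply: ler_wpM2r; first by rewrite invr_ge0 sqr_ge0.
  apply: ler_pM => //; first by rewrite mulr_ge0.
  by apply: ler_pM => //; apply: ler_wpM2r.
rewrite ler_pdivrMr ?exprn_gt0//.
rewrite (_ : 16 * _ * _ * 9 * 8 = 1152 * c * k%:R ^+ 3); last by ring.
have c1152 : 0 <= 1152 * c := mulr_ge0 (ler0n R 1152) c0.
apply: (le_trans (ler_wpM2l c1152 k3)).
rewrite natrM exprMn.
rewrite (_ : m%:R * M%:R / 144 * _ = m%:R ^+ 3 * (M%:R / 144)); last by ring.
rewrite (_ : 1152 * c * _ = m%:R ^+ 3 * (144 * 1152 * 16 ^+ 3 * c / 144)); last first.
  by field.
rewrite ler_wpM2l ?exprn_ge0 ?(ltW m0')// ler_pM2r ?invr_gt0//.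
exact: le_trans M1'.
Qed.

Theorem theorem5p2 (R : realType) :
  exists c : R, 0 < c /\
    forall (k l : nat) (eps : R),
      (2 <= k)%N -> ~~ odd k -> (1 <= l)%N -> 0 < eps -> eps < 2^-1 ->
      ((c * (k%:R ^+ 2 / (2 ^+ l * eps ^+ 2)))%:E
         <= public_coin_sample_complexity (all_channels R k l) eps)%E.
Proof.
have [c c0 c_le] : exists2 c : R, 0 < c & 144 * 1152 * 16 ^+ 3 * c <= 1.
  have : (0 : R) < 144 * 1152 * 16 ^+ 3 :=
    mulr_gt0 (mulr_gt0 (ltr0n R 144) (ltr0n R 1152)) (exprn_gt0 3 (ltr0n R 16)).
  move: (144 * _ * _) => C C0.
  by exists C^-1; rewrite ?invr_gt0// divff ?gt_eqF.
exists c; split=> //.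
move=> k l eps k2 k_even l1 eps0 eps2.
have k0 : (0 < k)%N := ltnW k2.
apply: le_ereal_inf_tmp => _ [n [Pi [phat est]] <-].
rewrite lee_fin leNgt; apply/negP => n_lt.
have l0 : 0 < 2 ^+ l :> R by rewrite exprn_gt0.
have cardY : #|{: l.-tuple bool}|%:R = 2 ^+ l :> R.
  by rewrite card_tuple card_bool natrX.
have small : n%:R * #|{: l.-tuple bool}|%:R * eps ^+ 2 <=
    c * k%:R ^+ 2.
  have leps0 : 0 < 2 ^+ l * eps ^+ 2 by rewrite mulr_gt0// exprn_gt0.
  by rewrite cardY -mulrA -ler_pdivlMr// -mulrA ltW.
(* At [7 / 32] one has [4 eps = 7 / 8], so the [g] of either branch is at most both [4 eps] and
   [7 / 8]. *)
have [eps7|eps7] := ltP eps (7 / 32).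
  have [m [m0 mk km]] :
      exists m, [/\ (0 < m)%N, (m * 2 <= k)%N & (0 < k <= 16 * m)%N].
    by exists k./2; clear -k2; split; lia.
  have [e e_inj] : exists e : 'I_m * 'I_2 -> 'I_k, injective e.
    exact: exists_block_embedding.
  have g01 : 0 <= 4 * eps <= 1 by apply/andP; split; lra.
  apply: (not_estimator (p := spiked_dist e g01 m0 k0) (phat := phat)) est.
    by rewrite card_ffun !card_ord expn_gt0.
  move=> u; apply: spiked_error_ge_small => //; first lra.
  by apply: (small_information _ _ _ (ltW c0) c_le _ _ _ _ small) => //; lra.
(* For [k < 8] and [n >= 1], [small] would force [2 (7 / 32)^2 <= 64 c], which the size of [c]
   forbids. *)
have [k8|k8] := ltnP k 8.
  have [n0|n0] := posnP n.
    by subst n; exact: no_sample_not_estimator est.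
  have n1 : (1 : R) <= n%:R by rewrite ler1n.
  have l2 : (2 : R) <= 2 ^+ l by rewrite -[leLHS]expr1 ler_weXn2l// ler1n.
  have k7 : k%:R ^+ 2 <= 8 ^+ 2 :> R.
    by rewrite lerXn2r ?nnegrE ?ler0n// ler_nat ltnW.
  have : 1 * 2 * (7 / 32) ^+ 2 <= n%:R * 2 ^+ l * eps ^+ 2.
    apply: ler_pM; rewrite ?mulr_ge0 ?exprn_ge0 ?divr_ge0//.
      by apply: ler_pM.
    by rewrite ler_sqr ?nnegrE ?divr_ge0 ?(ltW eps0).
  have : c * k%:R ^+ 2 <= c * 8 ^+ 2 :> R.
    by rewrite ler_wpM2l// ltW.
  by move: small; rewrite cardY; lra.
have [m [m0 mk km]] :
    exists m, [/\ (0 < m)%N, (m * 8 <= k)%N & (0 < k <= 16 * m)%N].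
  (* [m >= 1] gives [k < 8 (m + 1) <= 16 m]. *)
  by exists (k %/ 8)%N; clear -k8; split; lia.
have [e e_inj] : exists e : 'I_m * 'I_8 -> 'I_k, injective e.
  exact: exists_block_embedding.
have g01 : 0 <= (7 / 8 : R) <= 1 by apply/andP; split; lra.
apply: (not_estimator (p := spiked_dist e g01 m0 k0) (phat := phat)) est.
  by rewrite card_ffun !card_ord expn_gt0.
move=> u; apply: spiked_error_ge_large => //.
by apply: (small_information _ _ _ (ltW c0) c_le _ _ _ _ small) => //; lra.
Qed.
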